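(* For each $d\ge 2$ there exists an informationally complete Gabor POVM in $\mathbb{C}^d$, i.e. a unit vector $g\in\mathbb{C}^d$ with $\mathrm{rank}(G(g))=d^2$. Moreover, the set of all unit vectors $g\in\mathbb{C}^d$ such that $\mathrm{rank}(G(g))=d^2$ is open and dense in the unit sphere of $\mathbb{C}^d$.
   Context: Vectors in $\mathbb{C}^d$ are indexed by $\mathbb{Z}_d$, $\omega=e^{2\pi i/d}$. The modulation and translation operators are $(Mg)_n=\omega^ng_n$ and $(Tg)_n=g_{n-1}$ (indices mod $d$). For $(k,\ell)\in\mathbb{Z}_d\times\mathbb{Z}_d$ let $\Pi_{k,\ell}=(M^kT^\ell g)(M^kT^\ell g)^*$. The Gram matrix is the $d^2\times d^2$ matrix $G(g)=(\mathrm{tr}(\Pi_{k,\ell}\Pi_{k',\ell'}^* ))_{(k,\ell),(k',\ell')}$. The Gabor POVM generated by a unit vector $g$ is informationally complete if the $d^2$ matrices $\Pi_{k,\ell}$ form a basis of the space of complex $d\times d$ matrices, equivalently if $\mathrm{rank}(G(g))=d^2$. *)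

(* Defs.v *)
From HB Require Import structures.
From mathcomp Require Import all_boot all_order all_algebra.
From mathcomp Require Import complex.
From mathcomp Require Import all_classical all_reals all_analysis.

Set Implicit Arguments.
Unset Strict Implicit.
Unset Printing Implicit Defensive.

Import Order.TTheory GRing.Theory Num.Theory.
Import numFieldNormedType.Exports.

Local Open Scope classical_set_scope.
Local Open Scope ring_scope.
Local Open Scope complex_scope.
Local Open Scope sesquilinear_scope.

(* The topology of the modulus. The normed module structure of [R[i]^o] over
   [R[i]] is not copied: [R[i]] is already canonically a module over [R]. *)
HB.instance Definition _ (R : realType) :=
  PseudoPointedMetric.copy R[i] (R[i])^o.

Section Gabor.
Variables (R : realType) (d : nat).

(* e^(2 pi i / d), through Euler's formula *)
Definition omega : R[i] :=
  cos (2 * pi / d%:R) +i* sin (2 * pi / d%:R).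

(* The index set Z_d is ['I_d]; subtraction of 1 mod d is [ord_pred]. *)
Definition modulation (g : 'cV[R[i]]_d) : 'cV[R[i]]_d :=
  \col_(n < d) (omega ^+ n * g n 0).

Definition translation (g : 'cV[R[i]]_d) : 'cV[R[i]]_d :=
  \col_(n < d) g (ord_pred n) 0.

Definition gabor_vec (g : 'cV[R[i]]_d) (k l : 'I_d) : 'cV[R[i]]_d :=
  iter k modulation (iter l translation g).

Definition gabor_proj (g : 'cV[R[i]]_d) (p : 'I_d * 'I_d) : 'M[R[i]]_d :=
  gabor_vec g p.1 p.2 *m (gabor_vec g p.1 p.2)^t*.

(* Rows and columns are indexed by the pairs (k, l), numbered by [enum_val]. *)
Definition gram (g : 'cV[R[i]]_d) : 'M[R[i]]_#|{: 'I_d * 'I_d}| :=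
  \matrix_(i, j)
    \tr (gabor_proj g (enum_val i) *m (gabor_proj g (enum_val j))^t*).

Definition informationally_complete (g : 'cV[R[i]]_d) : Prop :=
  basis_of {: 'M[R[i]]_d} [seq gabor_proj g p | p : 'I_d * 'I_d].

Definition unit_sphere : set 'cV[R[i]]_d :=
  [set g | \sum_(n < d) `|g n 0| ^+ 2 = 1].

End Gabor.

Arguments unit_sphere R d : clear implicits.

(* Main.v *)
Require Import Defs.
From HB Require Import structures.
From mathcomp Require Import all_boot all_order all_algebra.
From mathcomp Require Import complex.
From mathcomp Require Import all_classical all_reals all_analysis.
From mathcomp Require Import ring lra.

Set Implicit Arguments.
Unset Strict Implicit.
Unset Printing Implicit Defensive.

Import Order.TTheory GRing.Theory Num.Theory.
Import numFieldNormedType.Exports.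

Local Open Scope classical_set_scope.
Local Open Scope ring_scope.

(** The proof rests on the discrete ambiguity function
      [ambiguity (m, s) x y = sum_j w^(m j) x_j conj(y_(j-s))],
    with [w = e^(2 pi i / d)].  The entries of the projection attached to
    [(k, l)] are [w^(k (a-b)) g_(a-l) conj(g_(b-l))].  Pairing this matrix with
    the time-frequency shift [(m, s)] gives
      [w^(k s + m l) * ambiguity (m, s) g g]:
    shifting [g] only multiplies its ambiguity function by a character.  So the
    matrix whose rows are the flattened projections, times an explicit matrix,
    equals the two-dimensional Fourier matrix times the diagonal matrix of the
    numbers [ambiguity p g g] ([gabor_proj_mx_mul_shift]).  The Fourier matrix
    is invertible, hence the projections form a basis exactly when no
    [ambiguity p g g] vanishes ([gabor_proj_mx_unit]).  As the Gram matrix is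
    [P P^*] for the same matrix [P], this is also the condition for it to have
    full rank ([rank_gram]).

    Openness: the condition says that finitely many continuous functions of
    [g] do not vanish.

    Density: each [ambiguity p] is a nonzero sesquilinear form, so by
    polarization it is nonzero on some diagonal pair [(v, v)].  For positive
    [t], [ambiguity p (x + t y) (x + t y)] is a polynomial in [t] with constant
    coefficient [ambiguity p x x] and [t^2]-coefficient [ambiguity p y y]; if
    one of them is nonzero, only finitely many [t] are roots, so all small
    [t > 0] are good ([ambiguity_perturb]).  Adding such perturbations for one
    index after another produces a vector [h] good for all indices
    ([generic_vector]).  Then for any unit vector [g], the vectors [g + t h]
    are good for all small [t > 0], and normalizing them keeps them good and
    keeps them converging to [g] ([normalized_cvg]).  Existence is density
    applied to the whole sphere. *)

(** * Limits over a numerically closed field *)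

Section ClosedFieldTopology.
Variable C : numClosedFieldType.

(** The right neighbourhoods of 0 are those along the positive, hence real,
    elements of [C]; a polynomial has finitely many roots. *)
Lemma near_right_not_root (p : {poly C}) :
  p != 0 -> \forall t \near (0 : C)^'+, p.[t] != 0.
Proof.
move=> p0; have [rs defp] := closed_field_poly_normal p.
have lp0 : lead_coef p != 0 by rewrite lead_coef_eq0.
have : \forall t \near (0 : C)^'+, t \notin rs.
  elim: rs {defp} => [|z rs IHrs]; first exact: nearW.
  have nz : \forall t \near (0 : C)^'+, t != z.
    have [z_gt0|z_le0] := boolP (0 < z).
      apply: filterS (nbhs_right_lt z_gt0) => t.
      by apply: contraTneq => ->; rewrite ltxx.
    by apply: filterS (nbhs_right_gt 0) => t; apply: contraTneq => ->.
  by apply: filterS2 nz IHrs => t; rewrite in_cons negb_or => ->.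
apply: filterS => t t_rs.
rewrite defp hornerZ mulf_neq0 // horner_prod.
elim: rs t_rs {defp} => [|z rs IHrs]; first by rewrite big_nil oner_eq0.
rewrite in_cons negb_or big_cons => /andP[tz /IHrs].
by rewrite hornerXsubC mulf_eq0 subr_eq0 (negbTE tz).
Qed.

Lemma conj_continuous : continuous (Num.conj : C -> C).
Proof.
move=> z; apply/(@cvgrPdist_lt _ _ _ _ (nbhs_filter z)) => e e_gt0.
have := @cvgr_dist_lt _ _ _ _ (nbhs_filter z) _ _ (@cvg_id _ (nbhs z)) _ e_gt0.
by apply: filterS => w; rewrite -rmorphB norm_conjC.
Qed.

Lemma cvg_mx (T : Type) (F : set_system T) m k (f : T -> 'M[C]_(m, k))
    (A : 'M[C]_(m, k)) :
  Filter F -> (forall i j, f t i j @[t --> F] --> A i j) ->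
  f t @[t --> F] --> A.
Proof.
move=> FF fA; apply/cvg_ballP => e e_gt0.
have : \forall t \near F, forall i j, ball (A i j) e (f t i j).
  apply: filter_forall => i; apply: filter_forall => j.
  by move/cvg_ballP: (fA i j); apply.
by apply: filterS => t; split.
Qed.

(** [sqrtC] brings nonnegative numbers closer to 1, since
    [x - 1 = (sqrtC x - 1) (sqrtC x + 1)] with [sqrtC x + 1 >= 1]. *)
Lemma sqrtC_continuous1 (T : Type) (F : set_system T) (f : T -> C) :
  Filter F -> (forall t, 0 <= f t) -> f t @[t --> F] --> (1 : C) ->
  sqrtC (f t) @[t --> F] --> (1 : C).
Proof.
move=> FF f_ge0 f1; apply/cvgrPdist_lt => e e_gt0.
move/cvgrPdist_lt/(_ e e_gt0): f1; apply: filterS => t.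
apply: le_lt_trans; rewrite -{2}[f t]sqrtCK -{2}[1](expr1n _ 2) subr_sqr normrM.
rewrite ler_peMr // ger0_norm ?addr_ge0 ?sqrtC_ge0 //.
by rewrite lerDl sqrtC_ge0.
Qed.

Lemma cvg_sum (T : Type) (F : set_system T) (I : finType) (f : I -> T -> C)
    (a : I -> C) : Filter F -> (forall i, f i t @[t --> F] --> a i) ->
  \sum_i f i t @[t --> F] --> \sum_i a i.
Proof. by move=> FF fa; apply: cvg_big => //; apply: add_continuous. Qed.

Lemma cvg_conj (T : Type) (F : set_system T) (f : T -> C) (a : C) :
  Filter F -> f t @[t --> F] --> a -> (f t)^* @[t --> F] --> a^*.
Proof.
by move=> FF fa; apply: continuous_cvg => //; apply: conj_continuous.
Qed.

(** Normalization lets the linear perturbation [g + t h] stay on the sphere.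
    The factor [c t] is the inverse of the norm of [g + t h]; its squared norm
    tends to that of [g], which is 1, so it is nonzero for small [t]. *)
Lemma normalized_cvg d (g h : 'cV[C]_d) : \sum_j `|g j 0| ^+ 2 = 1 ->
  exists2 c : C -> C,
   (\forall t \near (0 : C)^'+, \sum_j `|(c t *: (g + t *: h)) j 0| ^+ 2 = 1) &
   c t *: (g + t *: h) @[t --> (0 : C)^'+] --> g.
Proof.
move=> g1.
have line_cvg j : (g + t *: h) j 0 @[t --> (0 : C)^'+] --> g j 0.
  have -> : (fun t => (g + t *: h) j 0) = fun t => g j 0 + t * h j 0.
    by apply/funext => t; rewrite !mxE.
  have : g j 0 + t * h j 0 @[t --> (0 : C)] --> g j 0 + 0 * h j 0.
    apply: (@cvgD _ _ _ _ (nbhs_filter (0 : C)) (fun=> g j 0)).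
      exact: cvg_cst.
    apply: (@cvgM _ _ _ (nbhs_filter (0 : C))); first exact: cvg_id.
    exact: cvg_cst.
  by rewrite mul0r addr0 => /cvg_at_right_filter.
pose N t := \sum_j `|(g + t *: h) j 0| ^+ 2.
have N_ge0 t : 0 <= N t by apply: sumr_ge0 => j _; rewrite exprn_ge0.
have N_cvg : N t @[t --> (0 : C)^'+] --> (1 : C).
  rewrite -g1; apply: cvg_sum => j.
  rewrite normCK; under eq_fun do rewrite normCK.
  by apply: cvgM => //; apply: cvg_conj.
exists (fun t => (sqrtC (N t))^-1).
  have : \forall t \near (0 : C)^'+, N t != 0.
    by apply: (cvgr_neq0 _ N_cvg); rewrite oner_eq0.
  apply: filterS => t Nt.
  under eq_bigr => j _ do rewrite mxE normrM exprMn.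
  rewrite -mulr_sumr -/(N t) normrV ?unitfE ?sqrtC_eq0 //.
  rewrite ger0_norm ?sqrtC_ge0 //.
  by rewrite exprVn sqrtCK mulVf.
apply: cvg_mx => j k; rewrite ord1.
have -> : (fun t => ((sqrtC (N t))^-1 *: (g + t *: h)) j 0) =
    fun t => (sqrtC (N t))^-1 * (g + t *: h) j 0.
  by apply/funext => t; rewrite mxE.
rewrite -[X in _ --> X]mul1r -[X in X * _]invr1.
apply: cvgM => //; apply: cvgV; first by rewrite oner_eq0.
exact: sqrtC_continuous1.
Qed.

End ClosedFieldTopology.

(** * The primitive root of unity *)

Lemma omegaX (R : realType) (d m : nat) :
  omega R d ^+ m =
  (cos (2 * pi / d%:R * m%:R) +i* sin (2 * pi / d%:R * m%:R))%C.
Proof.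
rewrite /omega; set x := 2 * pi / d%:R.
elim: m => [|m IHm]; first by rewrite expr0 mulr0 cos0 sin0.
rewrite exprSr {}IHm -[m.+1%:R]natr1 (mulrDr x) mulr1 cosD sinD.
by apply/eqP; rewrite eq_complex /= eqxx [X in _ == X]addrC /=.
Qed.

(** If [0 < m < d], then [cos (2 m pi / d) = 1 - 2 sin (m pi / d)^2 < 1],
    because [m pi / d] lies strictly between 0 and [pi]. *)
Lemma omega_prim (R : realType) (d : nat) :
  (0 < d)%N -> d.-primitive_root (omega R d).
Proof.
move=> d_gt0; have dR : (d%:R : R) != 0 by rewrite pnatr_eq0 -lt0n.
apply/andP; split=> //; apply/forallP => i; apply/eqP.
rewrite unity_rootE omegaX.
have [->|ne_d] := eqVneq i.+1 d.
  by rewrite divfK // mulr_natl cos2pi sin2pi; apply/eqP.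
pose x : R := pi / d%:R * i.+1%:R.
have -> : 2 * pi / d%:R * i.+1%:R = x *+ 2.
  by rewrite -[x *+ 2]mulr_natl /x !mulrA.
suff sx : 0 < sin x.
  apply/negbTE; rewrite eq_complex /= negb_and cos_mulr2n cos2sin2.
  apply/orP; left.
  by rewrite lt_eqF // mulrnBl mulr2n; have := exprn_gt0 2 sx; lra.
apply: sin_gt0_pi; rewrite /x mulr_gt0 ?divr_gt0 ?pi_gt0 ?ltr0n //=.
rewrite mulrAC ltr_pdivrMr ?ltr0n // ltr_pM2l ?pi_gt0 // ltr_nat.
by rewrite ltn_neqAle ne_d ltn_ord.
Qed.

Lemma omega_conj (R : realType) (d : nat) : (omega R d)^* = (omega R d)^-1.
Proof.
have h : omega R d * (omega R d)^* = 1.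
  apply/eqP; rewrite eq_complex /=; apply/andP; split; apply/eqP; last by ring.
  by rewrite mulrN opprK -!expr2 cos2Dsin2.
have w0 : omega R d != 0.
  by apply/eqP => w0; move/eqP: h; rewrite w0 mul0r eq_sym oner_eq0.
by rewrite -[LHS](mulKf w0) h mulr1.
Qed.

(** * Characters of Z_d and the ambiguity function *)

(** The dimension is written [d.+2] so that ['I_d.+2] carries the ring
    structure of Z_d. *)
Section TimeFrequency.
Variables (R : realType) (d : nat).
Local Notation n := d.+2.
Local Notation I := 'I_n.
Local Notation C := R[i]%C.

Definition chi (a : I) : C := omega R n ^+ a.

Let w_prim : n.-primitive_root (omega R n).
Proof. exact: omega_prim. Qed.

Lemma chi0 : chi 0 = 1. Proof. by []. Qed.

Lemma chiD (a b : I) : chi (a + b) = chi a * chi b.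
Proof. by rewrite /chi -exprD /= (prim_expr_mod w_prim). Qed.

Lemma chiM (a b : I) : chi (a * b) = omega R n ^+ (a * b)%N.
Proof. by rewrite /chi /= (prim_expr_mod w_prim). Qed.

Lemma chi_neq0 (a : I) : chi a != 0.
Proof. by rewrite expf_neq0 // (prim_root_eq0 w_prim). Qed.

Lemma chiN (a : I) : chi (- a) = (chi a)^*.
Proof.
rewrite [in RHS]/chi rmorphXn /= omega_conj exprVn.
apply: (mulfI (chi_neq0 a)); rewrite -chiD addrN chi0.
by rewrite mulfV // chi_neq0.
Qed.

(** For [a <> 0] the translation [b -> 1 + b] multiplies the sum by
    [chi a], which is not 1. *)
Lemma sum_chi (a : I) : \sum_(b : I) chi (a * b) = (a == 0)%:R * n%:R.
Proof.
have [->|a0] := eqVneq a 0.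
  rewrite (eq_bigr (fun=> 1)); last by move=> b _; rewrite mul0r.
  by rewrite sumr_const card_ord mul1r.
have chi_a : chi a != 1.
  rewrite -(prim_order_dvd w_prim) gtnNdvd // lt0n.
  by apply: contra a0 => /eqP a0; apply/eqP/val_inj.
have : \sum_(b : I) chi (a * b) = chi a * \sum_(b : I) chi (a * b).
  rewrite mulr_sumr (reindex_inj (addrI 1)) /=.
  by apply: eq_bigr => b _; rewrite mulrDr mulr1 chiD.
move/eqP; rewrite -subr_eq0 -{1}[\sum_b _]mul1r -mulrBl mulf_eq0 subr_eq0.
by rewrite eq_sym (negbTE chi_a) mul0r => /eqP.
Qed.

(** The value at [p = (m, s)] is the Hermitian product of [x] with a
    time-frequency shift of [y]; on the diagonal it is the discrete ambiguity
    function of [x]. *)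
Definition ambiguity (p : I * I) (x y : 'cV[C]_n) : C :=
  \sum_(j : I) chi (p.1 * j) * x j 0 * (y (j - p.2) 0)^*.

Lemma iter_ord_pred (l : nat) (j : I) : iter l (@ord_pred n) j = j - l%:R.
Proof.
elim: l => [|l IHl]; first by rewrite subr0.
by rewrite iterS IHl -natr1 opprD addrA; apply/esym/(@sub_Zp_1 n).
Qed.

Lemma gabor_vecE (g : 'cV[C]_n) (k l j : I) :
  gabor_vec g k l j 0 = chi (k * j) * g (j - l) 0.
Proof.
rewrite /gabor_vec chiM exprM.
have transE m i : iter m (@translation R n) g i 0 = g (i - m%:R) 0.
  rewrite -iter_ord_pred; elim: m i => //= m IHm i.
  by rewrite mxE IHm -iterSr.
have modE m h : iter m (@modulation R n) h j 0 = omega R n ^+ m ^+ j * h j 0.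
  elim: m => [|m IHm]; first by rewrite expr0 expr1n mul1r.
  by rewrite iterS mxE IHm mulrA -exprMn -exprS.
by rewrite modE transE Zp_nat valZpK.
Qed.

Lemma gabor_projE (g : 'cV[C]_n) (p q : I * I) :
  gabor_proj g p q.1 q.2 =
  chi (p.1 * (q.1 - q.2)) * g (q.1 - p.2) 0 * (g (q.2 - p.2) 0)^*.
Proof.
rewrite /gabor_proj mxE big_ord1 !mxE !gabor_vecE mulrBr chiD chiN rmorphM /=.
by ring.
Qed.

(** * Factorization of the Gram matrix *)

Definition pair_mx (f : I * I -> I * I -> C) : 'M[C]_#|{: I * I}| :=
  \matrix_(i, j) f (enum_val i) (enum_val j).

Definition gabor_proj_mx (g : 'cV[C]_n) : 'M[C]_#|{: I * I}| :=
  pair_mx (fun p q => gabor_proj g p q.1 q.2).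

(** Column [(m, s)] holds the entries of the time-frequency shift that is
    paired with the projections, row [(a, b)] being the entry [(a, b)]: it is
    supported on the cyclic diagonal [b = a - s]. *)
Definition shift_mx : 'M[C]_#|{: I * I}| :=
  pair_mx (fun q p => (q.2 == q.1 - p.2)%:R * chi (p.1 * q.1)).

(** The Fourier matrix of Z_d x Z_d, with the components of the second index
    exchanged: time shifts are dual to modulations. *)
Definition fourier_mx : 'M[C]_#|{: I * I}| :=
  pair_mx (fun p q => chi (p.1 * q.2 + q.1 * p.2)).

Lemma sum_enum_pair (F : I * I -> C) :
  \sum_(i < #|{: I * I}|) F (enum_val i) = \sum_a \sum_b F (a, b).
Proof.
rewrite pair_bigA -(big_enum_val F).
by apply: eq_big => [p|[]].
Qed.

(** Orthogonality of characters: the conjugate transpose is an inverse up to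
    the factor [d^2]. *)
Lemma fourier_mx_unit : fourier_mx \in unitmx.
Proof.
suff h : fourier_mx *m ((n%:R ^- 2) *: (map_mx Num.conj fourier_mx)^T) = 1%:M.
  by case/mulmx1_unit: h.
apply/matrixP => i j; rewrite -scalemxAr !mxE.
(* Opaque names for the indices keep [enum_val] out of simplification. *)
have [p defp] : exists p, p = enum_val i by eexists.
have [q defq] : exists q, q = enum_val j by eexists.
transitivity (n%:R ^- 2 * \sum_(a : I) \sum_(b : I)
   chi ((p.1 - q.1) * b) * chi ((p.2 - q.2) * a)).
  congr (_ * _); rewrite -(sum_enum_pair (fun r => chi ((p.1 - q.1) * r.2) *
    chi ((p.2 - q.2) * r.1))).
  apply: eq_bigr => k _; rewrite !mxE -defp -defq -chiN -!chiD.
  by congr chi; ring.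
under eq_bigr => a _ do rewrite -mulr_suml sum_chi.
rewrite -mulr_sumr sum_chi !subr_eq0.
have -> : (i == j) = (p.1 == q.1) && (p.2 == q.2).
  by rewrite -(inj_eq enum_val_inj) -defp -defq; case: (p) (q) => ? ? [].
have nn : (n%:R : C) != 0 by rewrite pnatr_eq0.
case: (_ == _); case: (_ == _); rewrite /= ?(mul0r, mulr0) //.
by rewrite !mul1r -expr2 mulVf // expf_neq0.
Qed.

(** The shift by [l] is removed by the change of variable [j = a - l] in the
    pairing; it leaves the character value [w^(k s + m l)] in front of the
    ambiguity function. *)
Lemma gabor_proj_mx_mul_shift (g : 'cV[C]_n) :
  gabor_proj_mx g *m shift_mx =
  fourier_mx *m diag_mx (\row_j ambiguity (enum_val j) g g).
Proof.
apply/matrixP => i j; rewrite mul_mx_diag !mxE.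
have [p defp] : exists p, p = enum_val i by eexists.
have [q defq] : exists q, q = enum_val j by eexists.
rewrite -defp -defq.
transitivity (\sum_(a : I) \sum_(b : I) gabor_proj g p a b *
   ((b == a - q.2)%:R * chi (q.1 * a))).
  rewrite -(sum_enum_pair (fun r => gabor_proj g p r.1 r.2 *
   ((r.2 == r.1 - q.2)%:R * chi (q.1 * r.1)))).
  by apply: eq_bigr => k _; rewrite !mxE -defp -defq.
rewrite /ambiguity mulr_sumr [RHS](reindex_inj (addIr (- p.2))) /=.
apply: eq_bigr => a _.
rewrite (bigD1 (a - q.2)) //= big1 ?addr0; last first.
  by move=> b /negbTE ->; rewrite mul0r mulr0.
rewrite (gabor_projE g p (a, a - q.2)) /= eqxx mul1r.
have -> : a - (a - q.2) = q.2 by ring.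
have -> : a - q.2 - p.2 = a - p.2 - q.2 by ring.
have -> : chi (q.1 * a) = chi (q.1 * p.2) * chi (q.1 * (a - p.2)).
  by rewrite -chiD; congr chi; ring.
by rewrite chiD; ring.
Qed.

(** If all values are nonzero, the right-hand side of the factorization is
    invertible, hence so is its left factor.  If one value vanishes, the
    corresponding column of [shift_mx], which is nonzero, is in the kernel. *)
Lemma gabor_proj_mx_unit (g : 'cV[C]_n) :
  gabor_proj_mx g \in unitmx <-> (forall p, ambiguity p g g != 0).
Proof.
split=> [Pu p|amb]; last first.
  suff: gabor_proj_mx g *m shift_mx \in unitmx by rewrite unitmx_mul => /andP[].
  rewrite gabor_proj_mx_mul_shift unitmx_mul fourier_mx_unit unitmxE det_diag.
  by rewrite unitfE; apply/prodf_neq0 => i _; rewrite mxE.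
apply: contraNneq (chi_neq0 (p.1 * p.2)) => amb0.
set j := enum_rank p.
have : gabor_proj_mx g *m col j shift_mx = 0.
  rewrite colE mulmxA gabor_proj_mx_mul_shift -colE.
  by apply/colP => i; rewrite mul_mx_diag !mxE /j enum_rankK amb0 mulr0.
move/(canRL (mulKmx Pu)); rewrite mulmx0 => /colP/(_ (enum_rank (p.2, 0))).
by rewrite !mxE /j !enum_rankK /= subrr eqxx mul1r => ->.
Qed.

(** The trace of [A B^*] is the Hermitian product of the flattened matrices
    [A] and [B]. *)
Lemma gramE (g : 'cV[C]_n) :
  gram g = gabor_proj_mx g *m (map_mx Num.conj (gabor_proj_mx g))^T.
Proof.
apply/matrixP => i j; rewrite !mxE /mxtrace.
transitivity (\sum_a \sum_b gabor_proj g (enum_val i) a b *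
   (gabor_proj g (enum_val j) a b)^*).
  by apply: eq_bigr => a _; rewrite mxE; apply: eq_bigr => b _; rewrite !mxE.
rewrite -(sum_enum_pair (fun r => gabor_proj g (enum_val i) r.1 r.2 *
   (gabor_proj g (enum_val j) r.1 r.2)^*)).
by apply: eq_bigr => k _; rewrite !mxE.
Qed.

Lemma rank_gram (g : 'cV[C]_n) :
  \rank (gram g) = (n ^ 2)%N <-> (forall p, ambiguity p g g != 0).
Proof.
rewrite -gabor_proj_mx_unit.
have -> : (n ^ 2 = #|{: I * I}|)%N by rewrite card_prod card_ord.
have -> : (\rank (gram g) = #|{: I * I}|) <-> (gram g \in unitmx).
  by rewrite -row_free_unit /row_free; split=> [->|/eqP].
by rewrite gramE unitmx_mul unitmx_tr map_unitmx andbb.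
Qed.

(** The coefficients of a vanishing combination of the projections form a row
    vector killed by the invertible matrix [gabor_proj_mx g], so the family is
    free; it has as many members as the dimension. *)
Lemma informationally_completeP (g : 'cV[C]_n) :
  (forall p, ambiguity p g g != 0) -> informationally_complete g.
Proof.
move/gabor_proj_mx_unit => Pu.
rewrite /informationally_complete basisEfree subvf.
rewrite size_image card_prod card_ord dimvf /dim /= leqnn !andbT.
apply/(@freeP _ _ _ (in_tuple _)) => k.
have sz : size [seq gabor_proj g p | p : I * I] = #|{: I * I}|.
  by rewrite size_image.
move=> k0 i.
pose v : 'rV[C]_#|{: I * I}| := \row_j k (cast_ord (esym sz) j).
suff: v = 0 by move/rowP/(_ (cast_ord sz i)); rewrite !mxE cast_ordK.
rewrite -[v](mulmxK Pu).
suff -> : v *m gabor_proj_mx g = 0 by rewrite mul0mx.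
apply/rowP => j; rewrite !mxE.
move/matrixP/(_ (enum_val j).1 (enum_val j).2): k0.
rewrite summxE mxE; apply: etrans.
rewrite [RHS](reindex (cast_ord (esym sz))) /=; last first.
  by exists (cast_ord sz) => ? _; rewrite ?cast_ordK ?cast_ordKV.
by apply: eq_bigr => m _; rewrite nth_image !mxE.
Qed.

(** * Vectors on which no ambiguity form vanishes *)

Lemma ambiguityDl p (x1 x2 y : 'cV[C]_n) :
  ambiguity p (x1 + x2) y = ambiguity p x1 y + ambiguity p x2 y.
Proof.
by rewrite -big_split; apply: eq_bigr => j _ /=; rewrite mxE; ring.
Qed.

Lemma ambiguityDr p (x y1 y2 : 'cV[C]_n) :
  ambiguity p x (y1 + y2) = ambiguity p x y1 + ambiguity p x y2.
Proof.
by rewrite -big_split; apply: eq_bigr => j _ /=; rewrite mxE rmorphD /=; ring.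
Qed.

Lemma ambiguityZl p c (x y : 'cV[C]_n) :
  ambiguity p (c *: x) y = c * ambiguity p x y.
Proof.
by rewrite mulr_sumr; apply: eq_bigr => j _ /=; rewrite mxE; ring.
Qed.

Lemma ambiguityZr p c (x y : 'cV[C]_n) :
  ambiguity p x (c *: y) = c^* * ambiguity p x y.
Proof.
by rewrite mulr_sumr; apply: eq_bigr => j _ /=; rewrite mxE rmorphM /=; ring.
Qed.

Definition ambiguityE := (ambiguityDl, ambiguityDr, ambiguityZl, ambiguityZr).

(** Expanding at [x + y] and [x + 'i y] shows that [ambiguity p x y] is both
    the opposite of [ambiguity p y x] and equal to it. *)
Lemma ambiguity_polarization p :
  (forall v, ambiguity p v v = 0) -> forall x y, ambiguity p x y = 0.
Proof.
move=> amb0 x y.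
have := amb0 (x + y); rewrite !ambiguityE !amb0 addr0 add0r => sum0.
have := amb0 (x + 'i *: y); rewrite !ambiguityE !amb0 conjCi !mulr0 addr0 add0r.
move=> /eqP; rewrite mulNr addrC subr_eq0 => /eqP/(mulfI (neq0Ci _)) sym.
move: sum0; rewrite sym => /eqP.
by rewrite -mulr2n mulrn_eq0 => /eqP.
Qed.

(** The pair of basis vectors [(e_s, e_0)] has the nonzero value [w^(m s)]
    under the form of index [(m, s)]; polarization moves this to the
    diagonal. *)
Lemma ambiguity_neq0 p : exists v, ambiguity p v v != 0.
Proof.
apply: contrapT => /forallNP amb0.
have {}amb0 v : ambiguity p v v = 0 by apply/eqP/negP => /negP /amb0.
have := ambiguity_polarization amb0 (\col_j (j == p.2)%:R) (\col_j (j == 0)%:R).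
rewrite /ambiguity (bigD1 p.2) //= big1 => [|j /negbTE jp]; last first.
  by rewrite !mxE jp mulr0 mul0r.
rewrite !mxE subrr !eqxx conjC1 !mulr1 addr0 => /eqP.
by rewrite (negbTE (chi_neq0 _)).
Qed.

End TimeFrequency.

Section Generic.
Variables (R : realType) (d : nat).
Local Notation n := d.+2.
Local Notation I := 'I_n.
Local Notation C := R[i]%C.

(** For positive [t] the value at [x + t y] is a polynomial of degree at most 2
    in [t], because [t] is its own conjugate; its extreme coefficients are the
    values at [x] and [y]. *)
Lemma ambiguity_perturb (p : I * I) (x y : 'cV[C]_n) :
  ambiguity p x x != 0 \/ ambiguity p y y != 0 ->
  \forall t \near (0 : C)^'+, ambiguity p (x + t *: y) (x + t *: y) != 0.
Proof.
move=> xy0.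
pose P := Poly [:: ambiguity p x x; ambiguity p x y + ambiguity p y x;
  ambiguity p y y].
have P0 : P != 0.
  case: xy0; apply: contra_neq => P0.
    by have := coef_Poly [:: ambiguity p x x; ambiguity p x y + ambiguity p y x;
      ambiguity p y y] 0; rewrite -/P P0 coef0.
  by have := coef_Poly [:: ambiguity p x x; ambiguity p x y + ambiguity p y x;
      ambiguity p y y] 2; rewrite -/P P0 coef0.
apply: filterS2 (nbhs_right_gt 0) (near_right_not_root P0) => t t_gt0.
apply: contra_neq => amb0.
rewrite -amb0 horner_Poly /= !ambiguityE (CrealP (gtr0_real t_gt0)).
by ring.
Qed.

(** Indices are treated one at a time: a small multiple of a vector that is
    good for the new index is added, which spoils none of the earlier
    ones. *)
Lemma generic_vector : exists g : 'cV[C]_n, forall p, ambiguity p g g != 0.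
Proof.
suff [g amb] : exists g : 'cV[C]_n,
    forall p, p \in enum {: I * I} -> ambiguity p g g != 0.
  by exists g => p; apply: amb; rewrite mem_enum.
elim: (enum _) => [|p s [x amb_x]]; first by exists 0.
have [y amb_y] := ambiguity_neq0 R p.
have near_amb : \forall t \near (0 : C)^'+, forall q, q \in p :: s ->
    ambiguity q (x + t *: y) (x + t *: y) != 0.
  apply: filter_forall => q.
  have [qps|] := boolP (q \in p :: s); last by move=> _; apply: nearW.
  have : ambiguity q x x != 0 \/ ambiguity q y y != 0.
    move: qps; rewrite in_cons => /orP[/eqP ->|/amb_x]; [by right|by left].
  by move/ambiguity_perturb; apply: filterS.
have [t amb] := @filter_ex _ _ (at_right_proper_filter (0 : C)) _ near_amb.
by exists (x + t *: y).
Qed.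

Lemma ambiguity_continuous (p : I * I) :
  continuous (fun g : 'cV[C]_n => ambiguity p g g).
Proof.
move=> g; have nbhs_g : Filter (nbhs g) := nbhs_filter g.
apply: cvg_sum => j.
apply: cvgM; last first.
  apply: (@cvg_conj C _ _ (fun h : 'cV[C]_n => h (j - p.2) 0)).
  exact: (@coord_continuous C _ _ _ _ g).
by apply: cvgM; [exact: cvg_cst|exact: (@coord_continuous C _ _ _ _ g)].
Qed.

Lemma ambiguity_open :
  open [set g : 'cV[C]_n | forall p, ambiguity p g g != 0].
Proof.
rewrite openE => g amb; have nbhs_g : Filter (nbhs g) := nbhs_filter g.
apply: (@filter_forall _ _ _ _ nbhs_g) => p.
exact: (@cvgr_neq0 _ C^o _ _ nbhs_g _ _ (@ambiguity_continuous p g) (amb p)).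
Qed.

End Generic.

(** * Informational completeness is generic *)

Theorem proposition1 (R : realType) (d : nat) (hd : (2 <= d)%N) :
  (exists g : unit_sphere R d,
      informationally_complete (set_val g) /\
      \rank (gram (set_val g)) = (d ^ 2)%N) /\
  open [set g : unit_sphere R d | \rank (gram (set_val g)) = (d ^ 2)%N] /\
  dense [set g : unit_sphere R d | \rank (gram (set_val g)) = (d ^ 2)%N].
Proof.
case: d hd => [|[|d]] // _.
have -> : [set g : unit_sphere R d.+2 |
      \rank (gram (set_val g)) = (d.+2 ^ 2)%N] =
    set_val @^-1` [set g : 'cV[R[i]%C]_d.+2 | forall p, ambiguity p g g != 0].
  by apply/seteqP; split=> g /rank_gram.
have dense_amb : dense (set_val @^-1`
    [set g : 'cV[R[i]%C]_d.+2 | forall p, ambiguity p g g != 0]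
    : set (unit_sphere R d.+2)).
  move=> O [x Ox] [B Bopen BO].
  have [h amb_h] := generic_vector R d.
  have [c c_sphere c_cvg] := normalized_cvg h (set_valP x).
  have in_B : \forall t \near (0 : R[i]%C)^'+, B (c t *: (set_val x + t *: h)).
    apply: c_cvg; apply: open_nbhs_nbhs; split=> //.
    by move: Ox; rewrite -BO.
  have amb : \forall t \near (0 : R[i]%C)^'+, forall p,
      ambiguity p (set_val x + t *: h) (set_val x + t *: h) != 0.
    by apply: filter_forall => p; apply: ambiguity_perturb; right.
  have [t [[ct Bt] ambt]] :=
    @filter_ex _ _ (at_right_proper_filter (0 : R[i]%C)) _
    (filterI (filterI c_sphere in_B) amb).
  have sphere_t : c t *: (set_val x + t *: h) \in unit_sphere R d.+2.
    exact: mem_set.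
  exists (SigSub sphere_t); split; first by rewrite -BO.
  have ct0 : c t != 0.
    apply/eqP => c0; move: ct; rewrite c0 scale0r big1 => [/esym/eqP|j _].
      by rewrite oner_eq0.
    by rewrite mxE normr0 expr0n.
  by move=> p /=; rewrite ambiguityZl ambiguityZr !mulf_neq0 // conjC_eq0.
split; last split=> //; last first.
  apply: open_comp => [g _|]; last exact: ambiguity_open.
  exact: initial_continuous.
have e0_sphere : (\col_j (j == 0)%:R : 'cV[R[i]%C]_d.+2) \in unit_sphere R d.+2.
  apply: mem_set; rewrite /unit_sphere /= (bigD1 0) //= big1 => [|j /negbTE j0].
    by rewrite mxE eqxx normr1 expr1n addr0.
  by rewrite mxE j0 normr0 expr0n.
have [g [_ amb]] := dense_amb setT (ex_intro _ (SigSub e0_sphere) I) openT.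
by exists g; split; [exact: informationally_completeP|exact/rank_gram].
Qed.
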